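(* Let $n\ge 3$ be an odd integer and let $\mathbf{T}^1_n=\bigl(\tan(\tfrac{jk\pi}{n})\bigr)_{j,k\in S_n}$. Then $$\det(\mathbf{T}^1_n)=\varepsilon(n)\Bigl(\frac{n}{\pi}\Bigr)^{\frac{\phi(n)}{2}}\prod_{\chi\ \mathrm{odd}}\bigl(1-2\chi(2)\bigr)L(1,\chi),$$ where the product is over all odd Dirichlet characters $\chi$ modulo $n$.
   Context: $\phi$ is Euler's function. $S_n=\{a\in\mathbb{Z} : 1\le a<n/2,\ \gcd(a,n)=1\}$. $L(s,\chi)=\sum_{m\ge1}\chi(m)m^{-s}$ is the Dirichlet $L$-function; $\chi$ is odd if $\chi(-1)=-1$. For odd $n\ge3$ with factorization $n=\prod_{i=1}^r p_i^{e_i}$ ($p_i$ distinct odd primes, $e_i\ge 1$), the sign $\varepsilon(n)$ is defined by: - $\varepsilon(n)=(-1)^{\phi(n)/2}$ if $r=1$ and ($p_1\equiv 1\pmod 8$ or $p_1\equiv 4e_1+3\pmod 8$); - $\varepsilon(n)=(-1)^{\phi(n)/2+1}$ if $r=1$ and $p_1\not\equiv 1\pmod 8$ and $p_1\not\equiv 4e_1+3\pmod 8$; - $\varepsilon(n)=(-1)^{\phi(n)/2+1}$ if $r=2$ and $p_1+p_2\equiv 0\pmod 4$; - $\varepsilon(n)=(-1)^{\phi(n)/2}$ otherwise. *)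

(* Defs.v *)
From mathcomp Require Import all_boot all_order all_algebra.
From mathcomp Require Import complex.
From mathcomp Require Import all_classical all_reals all_analysis.

Set Implicit Arguments.
Unset Strict Implicit.
Unset Printing Implicit Defensive.

Import Order.TTheory GRing.Theory Num.Theory.
Import numFieldNormedType.Exports.

Local Open Scope classical_set_scope.
Local Open Scope ring_scope.
Local Open Scope complex_scope.

(* Every a with 1 <= a < n/2 is below n, so these integers live in 'I_n. *)
Definition halfunits (n : nat) : {set 'I_n} :=
  [set a : 'I_n | [&& (1 <= a)%N, (2 * a < n)%N & coprime a n]].

(* enum_val lists the elements of [halfunits n] in increasing order; the
   determinant does not depend on that ordering, as it is applied to rows and
   columns alike. *)
Definition tan_mx (R : realType) (n : nat) : 'M[R]_#|halfunits n| :=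
  \matrix_(j < #|halfunits n|, k < #|halfunits n|)
    let a : 'I_n := enum_val j in
    let b : 'I_n := enum_val k in
    tan (a%:R * b%:R * pi / n%:R).

(* [prime_decomp n] is the list of the pairs (p_i, e_i) such that n is the
   product of the p_i ^ e_i, by increasing p_i. *)
Definition eps (n : nat) : int :=
  match prime_decomp n with
  | [:: (p, e)] =>
      if (p == 1 %[mod 8])%N || (p == 4 * e + 3 %[mod 8])%N
      then (-1) ^+ (totient n)./2
      else (-1) ^+ ((totient n)./2 + 1)
  | [:: (p1, _); (p2, _)] =>
      if (p1 + p2 == 0 %[mod 4])%N
      then (-1) ^+ ((totient n)./2 + 1)
      else (-1) ^+ (totient n)./2
  | _ => (-1) ^+ (totient n)./2
  end.

(* Dirichlet characters modulo n, as functions on all of Z. *)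
Definition dirichlet_character (R : realType) (n : nat) (chi : int -> R[i]) :
    Prop :=
  [/\ forall a : int, chi (a + n%:Z) = chi a,
      forall a : int, chi a != 0 <-> coprimez a n%:Z
    & forall a b : int, chi (a * b) = chi a * chi b].

Definition odd_character (R : realType) (chi : int -> R[i]) : Prop :=
  chi (-1) = -1.

Definition odd_dirichlet_characters (R : realType) (n : nat) :
    set (int -> R[i]) :=
  [set chi | dirichlet_character n chi /\ odd_character chi].
Arguments odd_dirichlet_characters : clear implicits.

(* m ^ s = exp (s * ln m), for m >= 1 and complex s. *)
Definition natcpow (R : realType) (m : nat) (s : R[i]) : R[i] :=
  let x := complex.Re s * ln m%:R in
  let y := complex.Im s * ln m%:R in
  (expR x)%:C * (cos y +i* sin y).

(* Limit of the partial sums of the chi(m) m^-s, m >= 1, for the topology given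
   by the modulus (carried by the alias R[i]^o). No absolute convergence is
   required: at s = 1 the series only converges conditionally. *)
Definition dirichlet_L (R : realType) (s : R[i]) (chi : int -> R[i]) : R[i] :=
  limn (series (fun m : nat => chi m.+1%:Z * natcpow m.+1 (- s) : R[i]^o)).

(* Main.v *)
Require Import Defs.
From mathcomp Require Import all_boot all_order all_algebra.
From mathcomp Require Import complex.
From mathcomp Require Import all_classical all_reals all_analysis.
From mathcomp Require Import cyclic separable cyclotomic algC.
From mathcomp Require Import ring lra zify.

Set Implicit Arguments.
Unset Strict Implicit.
Unset Printing Implicit Defensive.

Import Order.TTheory GRing.Theory Num.Theory.
Import numFieldNormedType.Exports.

Local Open Scope ring_scope.
Local Open Scope complex_scope.

(** The matrix [tan (j k pi / n)], indexed by the half system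
    [S = {1 <= a < n / 2, a coprime to n}], is the multiplication table of an odd
    [n]-periodic function. Write [cot] for [z |-> cot (z pi / n)]. As
    [tan x = cot x - 2 cot (2 x)], that table factors ([det_prod_mx_sub]): its
    determinant is that of [1 - 2 T_2] times that of [sum_(k in S) cot (k) T_k]
    times that of [J], where

    - [T_g] is multiplication by [g] on the odd functions modulo [n], a signed
      permutation matrix in the basis indexed by [S];
    - [J] is the signed permutation matrix of [k |-> k^-1].

    The matrices [T_g], for [g] a unit, commute and have finite order, so that
    over the complex numbers they are simultaneously diagonal in some basis.
    Their joint eigenvalues are exactly the odd Dirichlet characters, once each
    ([odd_characters_diag]): this produces the [phi (n) / 2] odd characters
    without the structure of the group of units, and turns the first two
    determinants into the products over [chi] of [1 - 2 chi (2)] and of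
    [sum_(k in S) cot (k) chi (k)].

    The second factor is [(n / pi) L(1, chi)]. Expanding [chi] along [S] in the
    series reduces this to evaluating, for each [k], the sum over [m] of [+- 1 / m],
    with sign [+] for [m] congruent to [k] and [-] for [m] congruent to [- k]. That
    is the partial fraction expansion of the cotangent at [k / n]
    ([cvg_cot_partial_sum]). It is derived from the duplication formula
    [2 cot x = cot (x / 2) - cot ((pi - x) / 2)]: iterating it writes [cot] as a
    finite sum over a dyadic subdivision, in which every [cot y] may be replaced
    by [1 / y] because [cot y - 1 / y] is 1-Lipschitz on [(0, pi / 2]].

    There remains the sign [det J]. As [J] is an involution, it is
    [(-1) ^ ((#|S| - tr J) / 2)], and the trace of [J] is the number of solutions
    in [S] of [k^2 = 1] minus that of [k^2 = -1] modulo [n]. Both numbers are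
    multiplicative up to a factor 2. For a prime power the first one is 1 and
    the second one is 0 or 1; which of the two follows from the parity of
    [#|S| - tr J]. Comparing with the definition of [eps] is then a discussion
    modulo 8 ([det_invmul_mx]). *)

(** * Odd periodic functions on the integers *)

Lemma nat_residue (n : nat) (z : int) : (0 < n)%N ->
  exists2 r : nat, (r < n)%N & (n %| z - r%:Z)%Z.
Proof.
move=> n_gt0; have n0 : n%:Z != 0 by lia.
have rE : `|(z %% n)%Z|%N%:Z = (z %% n)%Z by rewrite gez0_abs ?modz_ge0.
exists `|(z %% n)%Z|%N; first by rewrite -ltz_nat rE ltz_pmod.
by rewrite rE {1}(divz_eq z n) addrK dvdz_mull.
Qed.

Lemma coprimez_congr (n : nat) (x y : int) :
  (n %| x - y)%Z -> coprimez x n = coprimez y n.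
Proof.
have imp u v : (n %| u - v)%Z -> coprimez u n -> coprimez v n.
  move=> /dvdzP[q /eqP]; rewrite subr_eq => /eqP -> /coprimezP[[a b] /= ab].
  by apply/coprimezP; exists (a, a * q + b); rewrite /= -ab; ring.
by move=> xy; apply/idP/idP; apply: imp; rewrite // -opprB rpredN.
Qed.

Lemma periodic_congr (T : Type) (n : nat) (f : int -> T) :
  (forall z, f (z + n%:Z) = f z) -> forall x y, (n %| x - y)%Z -> f x = f y.
Proof.
move=> per x y /dvdzP[q /eqP]; rewrite subr_eq => /eqP ->.
elim/int_ind: q => [|q IHq|q IHq]; first by rewrite mul0r add0r.
  by rewrite intS mulrDl mul1r -addrA addrC per.
by rewrite -[RHS]IHq -[LHS]per; congr f; rewrite intS; ring.
Qed.

Definition odd_periodic (V : zmodType) (n : nat) (f : int -> V) : Prop :=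
  (forall x y, (n %| x - y)%Z -> f x = f y) /\ (forall x, f (- x) = - f x).

Lemma odd_periodic_mull (V : zmodType) n (f : int -> V) (g : int) :
  odd_periodic n f -> odd_periodic n (fun z => f (g * z)).
Proof.
case=> per odd; split=> [x y xy|x]; last by rewrite mulrN odd.
by apply: per; rewrite -mulrBr dvdz_mull.
Qed.

(** The coefficient with which the value at [y] enters the value at [x] of an
    odd [n]-periodic function: [1] if [x] is congruent to [y], [-1] if [x] is
    congruent to [- y]. With entries of this form, the product of two matrices
    is computed by expanding an odd function along the half system. *)
Definition cong_sign (n : nat) (x y : int) : int :=
  ((n %| x - y)%Z : nat)%:Z - ((n %| x + y)%Z : nat)%:Z.

Lemma odd_periodic_cong_sign n y : odd_periodic n (cong_sign n ^~ y).
Proof.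
split=> [x x' dvd_xx'|x]; rewrite /cong_sign.
  have -> : x - y = (x - x') + (x' - y) by ring.
  have -> : x + y = (x - x') + (x' + y) by ring.
  by rewrite !(rpredDl _ dvd_xx').
have -> : - x - y = - (x + y) by ring.
have -> : - x + y = - (x - y) by ring.
by rewrite !rpredN; ring.
Qed.

Lemma cong_signC n x y : cong_sign n x y = cong_sign n y x.
Proof.
rewrite /cong_sign [y + x]addrC.
have -> : y - x = - (x - y) by ring.
by rewrite rpredN.
Qed.

(** [u] is invertible modulo [n], so it may be moved across the congruences
    as its inverse [v]. *)
Lemma cong_sign_mull (n : nat) (u v x y : int) : (n %| u * v - 1)%Z ->
  cong_sign n (u * x) y = cong_sign n x (v * y).
Proof.
move=> uv1.
have cu : coprimez n u.
  apply/coprimezP; move/dvdzP: uv1 => [q uv1].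
  by exists (- q, v); rewrite /= [v * u]mulrC; move/eqP: uv1; rewrite subr_eq => /eqP ->; ring.
have vuy : (n %| u * (v * y) - y)%Z.
  have -> : u * (v * y) - y = y * (u * v - 1) by ring.
  exact: dvdz_mull.
rewrite /cong_sign.
have -> : u * x - y = (u * (v * y) - y) + u * (x - v * y) by ring.
have -> : u * x + y = - (u * (v * y) - y) + u * (x + v * y) by ring.
rewrite rpredDl // rpredDl ?rpredN //.
by rewrite !Gauss_dvdzr.
Qed.

Lemma cong_sign_ncoprime (n : nat) (x y : int) :
  ~~ coprimez x n -> coprimez y n -> cong_sign n x y = 0.
Proof.
move=> ncx cy; rewrite /cong_sign.
have nd z : coprimez z n -> (n %| x - z)%Z = false.
  by move=> cz; apply/negP => /coprimez_congr; rewrite cz (negbTE ncx).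
rewrite nd // -{1}[y]opprK nd ?subrr //.
by rewrite coprimezE abszN -coprimezE.
Qed.

(** * The half system of units *)

Definition halfrep (n : nat) (i : 'I_#|halfunits n|) : int :=
  (enum_val i : nat)%:Z.

Lemma halfrepP n (i : 'I_#|halfunits n|) :
  exists a : nat, [/\ halfrep i = a%:Z, (1 <= a)%N, (2 * a < n)%N & coprime a n].
Proof.
exists (enum_val i); split=> //; have := enum_valP i;
  by rewrite inE => /and3P[].
Qed.

Lemma coprime_halfrep n (i : 'I_#|halfunits n|) : coprimez (halfrep i) n.
Proof. by have [a [-> _ _ ca]] := halfrepP i; rewrite coprimezE. Qed.

Lemma cong_sign_halfrep n (i j : 'I_#|halfunits n|) :
  cong_sign n (halfrep i) (halfrep j) = (i == j)%:R.
Proof.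
have [a [ai a1 an _]] := halfrepP i; have [b [bj b1 bn _]] := halfrepP j.
have -> : (i == j) = (a == b).
  rewrite -(inj_eq enum_val_inj) -val_eqE /=.
  by move: ai bj; rewrite /halfrep => -[->] [->].
rewrite ai bj /cong_sign.
have -> : (n %| a%:Z + b%:Z)%Z = false.
  by apply/negbTE/negP; rewrite -PoszD dvdzE /= => /dvdn_leq; lia.
have -> : (n %| a%:Z - b%:Z)%Z = (a == b).
  apply/idP/eqP => [|->]; last by rewrite subrr.
  rewrite dvdzE /= => dn; apply/eqP/negPn/negP => nab.
  by have := dvdn_leq _ dn; lia.
by rewrite subr0; case: (a == b).
Qed.

Lemma halfrep_eq1 n : (3 <= n)%N -> exists i : 'I_#|halfunits n|, halfrep i = 1.
Proof.
move=> n3; have n1 : (1 < n)%N by lia.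
have oneS : Ordinal n1 \in halfunits n by rewrite inE /= muln1 coprime1n; lia.
by exists (enum_rank_in oneS (Ordinal n1)); rewrite /halfrep enum_rankK_in.
Qed.

(** The half system represents the units modulo [n] up to sign: the residue
    of [z], or its opposite, is below [n / 2]. *)
Lemma halfunits_repr n (z : int) : (3 <= n)%N -> odd n -> coprimez z n ->
  exists i : 'I_#|halfunits n|,
    (n %| z - halfrep i)%Z \/ (n %| z + halfrep i)%Z.
Proof.
move=> n3 on cz.
have [r rn zr] := nat_residue z (ltn_trans (isT : 0 < 2)%N n3).
have cr : coprime r n by have := coprimez_congr zr; rewrite cz => /esym.
have r0 : (0 < r)%N.
  by case: r cr {rn zr} => // ; rewrite /coprime gcd0n; lia.
have mem k : (1 <= k)%N -> (2 * k < n)%N -> coprime k n ->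
    exists i : 'I_#|halfunits n|, halfrep i = k.
  move=> k1 k2 ck; have kn : (k < n)%N by lia.
  have kS : Ordinal kn \in halfunits n by rewrite inE k1 k2 ck.
  by exists (enum_rank_in kS (Ordinal kn)); rewrite /halfrep enum_rankK_in.
have [rlt|rge] := ltnP (2 * r) n.
  by have [i ir] := mem r r0 rlt cr; exists i; left; rewrite ir.
have [|||i ir] := mem (n - r)%N; [lia|lia| |].
  have nE := subnK (ltnW rn).
  by rewrite /coprime -{2}nE gcdnDl gcdnC -gcdnDr nE.
exists i; right; rewrite ir.
have -> : z + (n - r)%N%:Z = (z - r%:Z) + n%:Z by lia.
by rewrite rpredD.
Qed.

(** All terms of the sum vanish but the one of the representative of [z] up
    to sign. When [z] is not coprime to [n] there is no representative, and the
    expansion is of use for functions that vanish there, such as characters. *)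
Lemma odd_periodic_expand (K : pzRingType) n (f : int -> K) (z : int) :
    (3 <= n)%N -> odd n -> odd_periodic n f ->
    (~~ coprimez z n -> f z = 0) ->
  f z = \sum_(i < #|halfunits n|) (cong_sign n z (halfrep i))%:~R * f (halfrep i).
Proof.
move=> n3 on [fper fodd] fnc.
have [cz|ncz] := boolP (coprimez z n); last first.
  rewrite fnc // big1 // => i _.
  by rewrite cong_sign_ncoprime ?coprime_halfrep // mul0r.
have [i0 zi0] := halfunits_repr n3 on cz.
have [e fz tz] : exists2 e : int, f z = e%:~R * f (halfrep i0) &
    forall j : 'I_#|halfunits n|,
      cong_sign n z (halfrep j) = e * (i0 == j)%:R.
  case: zi0 => zi0; [exists 1|exists (-1)].
  - by rewrite mul1r; apply: fper.
  - move=> j; rewrite mul1r -cong_sign_halfrep.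
    by have [+ _] := odd_periodic_cong_sign n (halfrep j); apply.
  - by rewrite rmorphN1 mulN1r -fodd; apply: fper; rewrite opprK.
  - move=> j; rewrite mulN1r -cong_sign_halfrep.
    have [per odd] := odd_periodic_cong_sign n (halfrep j).
    by rewrite -odd; apply: per; rewrite opprK.
rewrite (bigD1 i0) //= big1 => [|j ji0]; last first.
  by rewrite tz eq_sym (negbTE ji0) mulr0 mul0r.
by rewrite addr0 tz eqxx mulr1.
Qed.

(** This is the expansion of [z |-> cong_sign n (g * z) j] at an inverse of [l]
    modulo [n]. It is the rule for composing multiplication by [g] with
    inversion. *)
Lemma sum_cong_sign (n : nat) (g j l : int) :
    (3 <= n)%N -> odd n -> coprimez j n -> coprimez l n ->
  \sum_(k < #|halfunits n|)
     cong_sign n (g * halfrep k) j * cong_sign n (halfrep k * l) 1 =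
  cong_sign n g (j * l).
Proof.
move=> n3 on cj cl.
have [v lv] : exists v : int, (n %| l * v - 1)%Z.
  move/coprimezP: cl => [[a b] /= ab]; exists a.
  by rewrite -ab; apply/dvdzP; exists (- b); ring.
have cv : coprimez v n.
  move/dvdzP: lv => [q lvq]; apply/coprimezP; exists (l, - q).
  by rewrite /= mulNr -lvq; ring.
have := @odd_periodic_expand _ n (fun z => cong_sign n (g * z) j) v n3 on.
rewrite -(cong_signC n (j * l)) (mulrC j) (cong_sign_mull _ _ lv).
rewrite cong_signC (mulrC v) => ->.
- apply: eq_bigr => k _; rewrite intz mulrC; congr (_ * _).
  by rewrite (mulrC _ l) (cong_sign_mull _ _ lv) mulr1 cong_signC.
- exact: odd_periodic_mull (odd_periodic_cong_sign n j).
- by rewrite cv.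
Qed.

(** * Odd characters as joint eigenvalues *)

(** The odd Dirichlet characters modulo [n], with values in any ring. *)
Definition odd_mult_periodic (C : nzRingType) n (f : int -> C) : Prop :=
  [/\ odd_periodic n f, forall g h, f (g * h) = f g * f h
    & forall g, f g != 0 <-> coprimez g n].

Lemma odd_mult_periodic1 (C : idomainType) n (f : int -> C) :
  odd_mult_periodic n f -> f 1 = 1.
Proof.
case=> _ mul nz; have f1 : f 1 != 0 by apply/nz; rewrite coprimezE coprime1n.
by apply: (mulfI f1); rewrite -mul !mulr1.
Qed.

(** ['X^N - 1] is a separable multiple of the minimal polynomial. *)
Lemma finite_order_diagonalizable (C : numClosedFieldType) m (A : 'M[C]_m) N :
  (0 < N)%N -> A ^+ N = 1 -> diagonalizable A.
Proof.
case: m A => [|m] A N0 AN1.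
  by exists 1%:M; rewrite ?unitmx1 // /similar_to /= flatmx0; apply/is_diag_mxP; case.
have [rs rsE] := closed_field_poly_normal ('X^N - 1 : {poly C}).
have Nlc : lead_coef ('X^N - 1 : {poly C}) = 1.
  by apply/eqP; rewrite -[_ == _]/(_ \is monic) -polyC1 monicXnsubC.
rewrite Nlc scale1r in rsE.
apply/diagonalizableP; exists rs.
  by rewrite -separable_prod_XsubC -rsE separable_Xn_sub_1 // pnatr_eq0 -lt0n.
rewrite -rsE; apply: mxminpoly_min.
by rewrite rmorphB rmorph1 rmorphXn /= horner_mx_X AN1 subrr.
Qed.

Section UnitMultiplication.
Variables (n : nat).
Hypotheses (n_ge3 : (3 <= n)%N) (n_odd : odd n).
Local Notation m := #|halfunits n|.
Local Notation rep := (@halfrep n).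
Local Notation t := (cong_sign n).

(** The operator taking [f] to [x |-> f (g * x)] on the odd functions modulo [n]
    that vanish off the units, acting on the row vectors of the values of these
    functions on the half system. It is zero when [g] is not a unit. *)
Definition unitmul_mx (K : pzRingType) (g : int) : 'M[K]_m :=
  \matrix_(j, k) (t (g * rep k) (rep j))%:~R.

Section Ring.
Variable K : pzRingType.
Local Notation T := (@unitmul_mx K).

Lemma unitmul_mx_period g h : (n %| g - h)%Z -> T g = T h.
Proof.
move=> gh; apply/matrixP => j k; rewrite !mxE; congr (_%:~R).
have [per _] := odd_periodic_cong_sign n (rep j); apply: per.
by rewrite -mulrBl dvdz_mulr.
Qed.

Lemma unitmul_mxN g : T (- g) = - T g.
Proof.
apply/matrixP => j k; rewrite !mxE mulNr.
by have [_ ->] := odd_periodic_cong_sign n (rep j); rewrite rmorphN.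
Qed.

Lemma unitmul_mx1 : T 1 = 1%:M.
Proof.
by apply/matrixP => j k; rewrite !mxE mul1r cong_sign_halfrep rmorph_nat eq_sym.
Qed.

Lemma unitmul_mx_ncoprime g : ~~ coprimez g n -> T g = 0.
Proof.
move=> ncg; apply/matrixP => j k; rewrite !mxE cong_sign_ncoprime //.
  by rewrite coprimezMl negb_and ncg.
exact: coprime_halfrep.
Qed.

Lemma unitmul_mxM g h : T (g * h) = T g *m T h.
Proof.
apply/matrixP => j l; rewrite !mxE.
have [per odd] := odd_periodic_mull g (odd_periodic_cong_sign n (rep j)).
have := @odd_periodic_expand K n (fun z => (t (g * z) (rep j))%:~R) (h * rep l)
   n_ge3 n_odd.
rewrite mulrA => ->.
- apply: eq_bigr => k _; rewrite !mxE -!intrM; congr (_%:~R).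
  by rewrite mulrC.
- split=> [x y xy|x]; last by rewrite odd rmorphN.
  by congr (_%:~R); apply: per.
- move=> nc; rewrite cong_sign_ncoprime ?coprime_halfrep //.
  by rewrite -mulrA coprimezMl negb_and nc orbT.
Qed.

Lemma unitmul_mxX g k : T (g ^+ k) = T g ^+ k.
Proof.
elim: k => [|k IHk]; first by rewrite !expr0 unitmul_mx1.
by rewrite !exprS unitmul_mxM IHk.
Qed.

Lemma unitmul_mx_totient g : coprimez g n -> T g ^+ totient n = 1.
Proof.
move=> cg; have [r _ gr] := nat_residue g (ltn_trans (isT : 0 < 2)%N n_ge3).
have cr : coprime r n by have := coprimez_congr gr; rewrite cg => /esym.
rewrite (unitmul_mx_period gr) -unitmul_mxX -[1]unitmul_mx1.
apply: unitmul_mx_period.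
rewrite -eqz_mod_dvd -rmorphXn /=.
by rewrite !modz_nat (Euler_exp_totient cr).
Qed.

End Ring.

(** These matrices commute, and those of the units have finite order by Euler's
    theorem: the hypothesis on the field makes each of them diagonalizable, and
    then all of them are diagonal in a common basis. *)
Lemma unitmul_codiagonalizable (C : fieldType) :
    (forall (A : 'M[C]_m) N, (0 < N)%N -> A ^+ N = 1 -> diagonalizable A) ->
  exists2 P : 'M[C]_m, P \in unitmx & exists chi : 'I_m -> int -> C,
    forall g, P *m unitmul_mx C g = diag_mx (\row_i chi i g) *m P.
Proof.
move=> fin_diag; pose As := [seq unitmul_mx C g%:Z | g <- iota 0 n].
have [P Pu PA] : codiagonalizable As.
  apply/codiagonalizableP; split=> [A B|A].
    by move=> /mapP[a _ ->] /mapP[b _ ->]; rewrite /comm_mx -!unitmul_mxM mulrC.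
  move=> /mapP[a _ ->]; have [ca|nca] := boolP (coprimez a n).
    apply: (@fin_diag _ (totient n)); first by rewrite totient_gt0; lia.
    exact: unitmul_mx_totient.
  by rewrite unitmul_mx_ncoprime //; apply: diagonalizable0.
exists P => //; pose D g := P *m unitmul_mx C g *m invmx P.
exists (fun i g => D g i i) => g.
suff /is_diag_mxP Dg : is_diag_mx (D g).
  rewrite (_ : diag_mx _ = D g) ?mulmxKV //.
  apply/matrixP => i j; rewrite mxE (mxE _ _ 0 i).
  by have [->|ij] := eqVneq i j; rewrite ?mulr1n // (Dg i j).
have [r rn gr] := nat_residue g (ltn_trans (isT : 0 < 2)%N n_ge3).
have /(allP PA) : unitmul_mx C g \in As.
  rewrite (unitmul_mx_period _ gr); apply: (map_f (fun a : nat => unitmul_mx C a%:Z)).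
  by rewrite mem_iota.
by rewrite /= /similar_to conjumx.
Qed.

(** The column of the representative 1 in a combination of these matrices lists
    its coefficients. *)
Lemma unitmul_comb_eq0 (K : pzRingType) (a : 'I_m -> K) :
  \sum_k a k *: unitmul_mx K (rep k) = 0 -> forall k, a k = 0.
Proof.
have [k1 rep1] := halfrep_eq1 n_ge3.
move=> sum0 j; have := congr1 (fun A : 'M[K]_m => A j k1) sum0.
rewrite summxE !mxE (bigD1 j) //= big1 => [|k kj]; last first.
  by rewrite !mxE rep1 mulr1 cong_sign_halfrep (negbTE kj) mulr0.
by rewrite !mxE rep1 mulr1 cong_sign_halfrep eqxx mulr1 addr0.
Qed.

(** The joint eigenvalues of the [unitmul_mx g] are multiplicative in [g] because
    these matrices are, hence odd characters. They are distinct because the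
    [unitmul_mx] of the half system, [#|halfunits n|] in number, are linearly
    independent, so the square matrix of the values of the eigenvalues is
    invertible. They exhaust the odd characters because an odd character, read
    as a vector, is itself a joint eigenvector. The last clause evaluates the
    determinant of a linear combination in the eigenbasis. *)
Lemma odd_characters_diag (C : fieldType) :
    (forall (A : 'M[C]_m) N, (0 < N)%N -> A ^+ N = 1 -> diagonalizable A) ->
  exists chi : 'I_m -> int -> C,
    [/\ injective chi, forall i, odd_mult_periodic n (chi i),
        forall f, odd_mult_periodic n f -> exists i, chi i = f
      & forall (I : finType) (a : I -> C) (g : I -> int),
          \det (\sum_x a x *: unitmul_mx C (g x)) =
          \prod_i \sum_x a x * chi i (g x)].
Proof.
move=> fin_diag; have [P Pu [chi chiP]] := unitmul_codiagonalizable fin_diag.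
pose T := unitmul_mx C.
pose d g := \row_i chi i g.
have dP g M : diag_mx (d g) = M -> forall i, chi i g = M i i.
  by move=> <- i; rewrite !mxE eqxx.
have PI : injective (mulmx ^~ P : 'M[C]_m -> 'M[C]_m).
  exact: can_inj (mulmxK Pu).
have chi0 i g : T g = 0 -> chi i g = 0.
  move=> Tg0; rewrite (dP g 0) ?mxE //.
  by apply: PI; rewrite -chiP -/(T g) Tg0 mulmx0 mul0mx.
have chi1 i : chi i 1 = 1.
  rewrite (dP 1 1%:M) ?mxE ?eqxx //; apply: PI.
  by rewrite -chiP unitmul_mx1 mulmx1 mul1mx.
have chiN i g : chi i (- g) = - chi i g.
  rewrite (dP _ (- diag_mx (d g))) ?mxE ?eqxx //; apply: PI.
  by rewrite -chiP unitmul_mxN mulmxN chiP mulNmx.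
have chiper i g h : (n %| g - h)%Z -> chi i g = chi i h.
  move=> gh; rewrite (dP g (diag_mx (d h))) ?mxE ?eqxx //; apply: PI.
  by rewrite -!chiP (unitmul_mx_period _ gh).
have chiM i g h : chi i (g * h) = chi i g * chi i h.
  rewrite (dP _ (diag_mx (d g) *m diag_mx (d h))); last first.
    by apply: PI; rewrite -chiP unitmul_mxM // mulmxA chiP -mulmxA chiP mulmxA.
  by rewrite mulmx_diag !mxE eqxx.
have sumD (I : finType) (a : I -> C) (g : I -> int) :
    P *m (\sum_x a x *: T (g x)) =
      diag_mx (\row_i \sum_x a x * chi i (g x)) *m P.
  rewrite mulmx_sumr (_ : diag_mx _ = \sum_x a x *: diag_mx (d (g x))).
    rewrite mulmx_suml; apply: eq_bigr => x _.
    by rewrite -scalemxAr -scalemxAl chiP.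
  apply/matrixP => i j; rewrite summxE !mxE -sumrMnl; apply: eq_bigr => x _.
  by rewrite !mxE mulrnAr.
exists chi; split.
- pose X : 'M[C]_m := \matrix_(k, i) chi i (rep k).
  have Xu : X \in unitmx.
    rewrite -row_free_unit; apply: inj_row_free => v vX0.
    have /unitmul_comb_eq0 v0 : \sum_k v 0 k *: T (rep k) = 0.
      apply: (can_inj (mulKmx Pu)); rewrite sumD mulmx0.
      rewrite (_ : \row_i _ = 0) ?raddf0 ?mul0mx //.
      apply/rowP => i; rewrite -vX0 !mxE.
      by apply: eq_bigr => k _; rewrite mxE.
    by apply/rowP => k; rewrite v0 // mxE.
  (* Equal eigenvalues would give two equal columns of [X]. *)
  move=> i j chiij; apply/eqP/negPn/negP => ij.
  move: Xu; rewrite unitmxE -det_tr (determinant_alternate ij) ?unitr0 //.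
  by move=> k; rewrite !mxE chiij.
- move=> i; split=> // [|g].
    by split=> [x y|x]; [exact: chiper|exact: chiN].
  split=> [|/coprimezP[[u v] /= uv]].
    apply: contraNT => ncg.
    by rewrite chi0 //; apply: unitmul_mx_ncoprime.
  have : chi i (u * g) = 1.
    rewrite -(chi1 i); apply: chiper.
    by rewrite -uv; apply/dvdzP; exists (- v); ring.
  by rewrite chiM => /eqP; apply: contraTneq => ->; rewrite mulr0 eq_sym oner_eq0.
- move=> f fomp; have [fper fM fnz] := fomp; pose v : 'rV[C]_m := \row_k f (rep k).
  have vT g : v *m T g = f g *: v.
    apply/rowP => k; rewrite !mxE -fM.
    rewrite (odd_periodic_expand n_ge3 n_odd fper).
      by apply: eq_bigr => j _; rewrite !mxE mulrC.
    by move=> /negP nc; apply/eqP/negPn/negP => /fnz.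
  pose w := v *m invmx P.
  have wD g : w *m diag_mx (d g) = f g *: w.
    apply: (can_inj (mulmxK Pu)).
    by rewrite -mulmxA -chiP mulmxA -scalemxAl mulmxKV.
  (* A coordinate in the eigenbasis where [v] does not vanish selects [i]. *)
  have [i wi] : exists i, w 0 i != 0.
    apply: contrapT => /forallNP w0.
    have v0 k : f (rep k) = 0.
      have -> : f (rep k) = (w *m P) 0 k by rewrite mulmxKV // mxE.
      by rewrite mxE big1 // => i _; have /negP/negPn/eqP -> := w0 i; rewrite mul0r.
    have : f 1 != 0 by rewrite (odd_mult_periodic1 fomp) oner_eq0.
    case/negP; rewrite (odd_periodic_expand n_ge3 n_odd fper) ?coprimezE ?coprime1n //.
    by rewrite big1 // => k _; rewrite v0 mulr0.
  exists i => //; apply/funext => g; apply: (mulfI wi).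
  have := congr1 (fun A : 'rV[C]_m => A 0 i) (wD g).
  by rewrite mul_mx_diag !mxE => ->; rewrite mulrC.
- move=> I a g.
  have detP : \det P != 0 by rewrite -unitfE -unitmxE.
  apply: (mulfI detP); rewrite -det_mulmx sumD det_mulmx det_diag mulrC.
  by congr (_ * _); apply: eq_bigr => i _; rewrite mxE.
Qed.

End UnitMultiplication.

(** * Multiplication tables of odd functions *)

Section OddFunctionMatrix.
Variables (n : nat).
Hypotheses (n_ge3 : (3 <= n)%N) (n_odd : odd n).
Local Notation m := #|halfunits n|.
Local Notation rep := (@halfrep n).
Local Notation t := (cong_sign n).

Definition invmul_mx (K : pzRingType) : 'M[K]_m :=
  \matrix_(j, k) (t (rep j * rep k) 1)%:~R.

Definition prod_mx (K : pzRingType) (f : int -> K) : 'M[K]_m :=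
  \matrix_(j, k) f (rep j * rep k).

(** Inversion is an involution on the units. *)
Lemma invmul_mx_involutive (K : pzRingType) :
  invmul_mx K *m invmul_mx K = 1%:M.
Proof.
apply/matrixP => j l; rewrite !mxE.
have c1 : coprimez 1 n by rewrite coprimezE coprime1n.
have := sum_cong_sign (rep j) n_ge3 n_odd c1 (coprime_halfrep l).
rewrite mul1r cong_sign_halfrep => /(congr1 (fun z : int => z%:~R : K)).
rewrite rmorph_nat => <-; rewrite rmorph_sum; apply: eq_bigr => k _.
by rewrite !mxE rmorphM.
Qed.

(** Expand [f] along the half system and decompose [k |-> cong_sign n k (j * l)]
    by [sum_cong_sign]. *)
Lemma prod_mxE (K : comPzRingType) (f : int -> K) : odd_periodic n f ->
  prod_mx f = (\sum_k f (rep k) *: unitmul_mx n K (rep k)) *m invmul_mx K.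
Proof.
move=> fper; apply/matrixP => j l; rewrite !mxE.
have cjl : coprimez (rep j * rep l) n by rewrite coprimezMl !coprime_halfrep.
rewrite (odd_periodic_expand n_ge3 n_odd fper) ?cjl //.
transitivity (\sum_(k < m) \sum_(i < m)
    f (rep k) * (t (rep k * rep i) (rep j) * t (rep i * rep l) 1)%:~R).
  apply: eq_bigr => k _; rewrite mulrC -mulr_sumr -rmorph_sum; congr (_ * _%:~R).
  by rewrite sum_cong_sign ?coprime_halfrep // cong_signC.
rewrite exchange_big; apply: eq_bigr => i _.
rewrite summxE mulr_suml; apply: eq_bigr => k _.
by rewrite !mxE rmorphM mulrA.
Qed.

(** Row [j] of the left-hand side is the row of [g * j] in the table of [f], and
    [g * j] is a signed representative. *)
Lemma prod_mx_mul (K : comPzRingType) (f : int -> K) (g : int) :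
  odd_periodic n f -> coprimez g n ->
  prod_mx (fun x => f (g * x)) = (unitmul_mx n K g)^T *m prod_mx f.
Proof.
move=> [fper fodd] cg; apply/matrixP => j l; rewrite !mxE.
have := @odd_periodic_expand K n (fun z => f (z * rep l)) (g * rep j) n_ge3 n_odd.
rewrite mulrA => ->; first by apply: eq_bigr => k _; rewrite !mxE.
  split=> [x y xy|x]; last by rewrite mulNr fodd.
  by apply: fper; rewrite -mulrBl dvdz_mulr.
by rewrite coprimezMl cg coprime_halfrep.
Qed.

(** For [f] the cotangent and [a = g = 2], the matrix on the left is the table of
    the tangent. *)
Lemma det_prod_mx_sub (K : comPzRingType) (f : int -> K) (a : K) (g : int) :
  odd_periodic n f -> coprimez g n ->
  \det (prod_mx (fun x => f x - a * f (g * x))) =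
  \det (1%:M - a *: unitmul_mx n K g) *
  \det (\sum_k f (rep k) *: unitmul_mx n K (rep k)) * \det (invmul_mx K).
Proof.
move=> fper cg; rewrite -mulrA -det_mulmx -prod_mxE //.
rewrite -[X in _ = X * _]det_tr -det_mulmx; congr (\det _).
rewrite linearB /= trmx1 linearZ /= mulmxBl mul1mx -scalemxAl -prod_mx_mul //.
by apply/matrixP => j k; rewrite !mxE.
Qed.

End OddFunctionMatrix.

(** * The determinant of the inversion matrix *)

(** [b] is the multiplicity of the eigenvalue [-1]. *)
Lemma det_involution (C : numClosedFieldType) m (A : 'M[C]_m) :
  A *m A = 1%:M ->
  exists2 b : nat, \det A = (-1) ^+ b & \tr A + (2 * b)%:R = m%:R.
Proof.
move=> AA; have [P Pu] := @finite_order_diagonalizable C m A 2 isT AA.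
rewrite /similar_to conjumx // => /is_diag_mxP Dd.
set D := P *m A *m invmx P in Dd.
have DD : D *m D = 1%:M.
  by rewrite /D !mulmxA mulmxKV // -(mulmxA P A A) AA mulmx1 mulmxV.
have detA : \det A = \det D.
  rewrite !det_mulmx mulrC mulrA -det_mulmx mulVmx // det1 mul1r //.
have trA : \tr A = \tr D by rewrite mxtrace_mulC mulmxA mulVmx // mul1mx.
clearbody D.
have Dii i : D i i = (-1) ^+ (D i i == -1).
  have := congr1 (fun M : 'M[C]_m => M i i) DD.
  rewrite !mxE eqxx (bigD1 i) //= big1 ?addr0; last first.
    by move=> k ki; rewrite (Dd i k) ?mul0r // eq_sym.
  move=> /eqP; rewrite -expr2 sqrf_eq1 => /orP[] /eqP ->; last by rewrite eqxx.
  by rewrite gt_eqF ?expr0 // (lt_trans (ltrN10 _)) ?ltr01.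
have DE : D = diag_mx (\row_i (-1) ^+ (D i i == -1)).
  apply/matrixP => i j; rewrite !mxE.
  by have [<-|ij] := eqVneq i j; rewrite ?mulr1n ?mulr0n // (Dd i j).
exists (\sum_i (D i i == -1)%R)%N.
  rewrite detA {1}DE det_diag.
  rewrite (big_morph _ (exprD (-1 : C)) (expr0 _)).
  by apply: eq_bigr => i _; rewrite mxE.
rewrite trA {1}DE mxtrace_diag big_distrr /= natr_sum -big_split /=.
rewrite (eq_bigr (fun=> 1)) => [|i _]; last first.
  by rewrite mxE; case: (_ == _); rewrite ?expr1 ?expr0 /= natrM ?mulr0 ?addr0 //; ring.
by rewrite sumr_const card_ord.
Qed.

Definition half_sqrt_count n (s : int) : nat :=
  #|[set i : 'I_#|halfunits n| | (n %| halfrep i ^+ 2 - s)%Z]|.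

(** Pair [x] with [n - x]: exactly one of them is below [n / 2]. *)
Lemma sum_symmetric_halfunits n (P : nat -> bool) :
    (3 <= n)%N -> odd n ->
    (forall x, (x <= n)%N -> P (n - x)%N = P x) ->
    (forall x, P x -> coprime x n) ->
  (\sum_(x < n) P x = 2 * \sum_(i < #|halfunits n|) P (enum_val i))%N.
Proof.
move=> n3 on symP copP.
have P0 : P 0 = false.
  by apply/negP => /copP; rewrite /coprime gcd0n; lia.
pose Q x := P x && (2 * x < n)%N.
have sumQ : (\sum_(1 <= x < n) Q x)%N = (\sum_(i < #|halfunits n|) P (enum_val i))%N.
  rewrite -(big_enum_val (A := mem (halfunits n)) (fun x : 'I_n => nat_of_bool (P x))) /=.
  rewrite [RHS]big_mkcond /=.
  transitivity (\sum_(x < n) ([&& P x, 1 <= x & 2 * x < n] : nat))%N.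
    rewrite -(big_mkord xpredT (fun x => nat_of_bool
      [&& P x, 1 <= x & 2 * x < n]%N)) [RHS]big_ltn ?P0 ?add0n; last by lia.
    by rewrite !big_nat; apply: eq_bigr => x /andP[x0 _]; rewrite /Q x0.
  apply: eq_bigr => x _; rewrite inE.
  have [Px|] := boolP (P x); last by case: ifP.
  by rewrite (copP _ Px) andbT /=; case: (_ && _).
rewrite -(big_mkord xpredT (fun x => nat_of_bool (P x))) big_ltn ?P0 ?add0n; last by lia.
transitivity (\sum_(1 <= x < n) (Q x + Q (n - x)))%N.
  rewrite !big_nat; apply: eq_bigr => x /andP[x0 xn].
  rewrite /Q symP ?(ltnW xn) //; case: (P x) => //=.
  by case: ltnP; case: ltnP; lia.
rewrite big_split /= mul2n -addnn -sumQ; congr (_ + _)%N.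
rewrite big_nat_rev /= !big_nat; apply: eq_bigr => x /andP[x0 xn].
by congr (nat_of_bool (Q _)); lia.
Qed.

Lemma totient_halfunits n : (3 <= n)%N -> odd n -> totient n = (2 * #|halfunits n|)%N.
Proof.
move=> n3 on; rewrite totient_count_coprime big_mkord.
rewrite (eq_bigr (fun x : 'I_n => nat_of_bool (coprime x n))) => [|x _]; last first.
  by rewrite coprime_sym.
rewrite (@sum_symmetric_halfunits n (fun x => coprime x n)) // => [|x xn].
  congr (_ * _)%N; rewrite (eq_bigr (fun=> 1%N)) ?sum1_card ?card_ord // => i _.
  by have := enum_valP i; rewrite inE => /and3P[_ _ ->].
have nE := subnK xn; rewrite coprime_sym [RHS]coprime_sym /coprime.
by congr (_ == _); rewrite gcdnC -{2}nE gcdnDl gcdnC -gcdnDr nE gcdnC.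
Qed.

Definition is_sqrt_mod (n : nat) (s : int) (x : nat) : bool :=
  (n %| x%:Z ^+ 2 - s)%Z.

Lemma sqrt_modN (n x : nat) (s : int) : (x <= n)%N ->
  is_sqrt_mod n s (n - x) = is_sqrt_mod n s x.
Proof.
move=> xn; rewrite /is_sqrt_mod.
have -> : (n - x)%N%:Z ^+ 2 - s = (n%:Z * (n%:Z - 2 * x%:Z)) + (x%:Z ^+ 2 - s).
  by rewrite -subzn //; ring.
by rewrite rpredDl // dvdz_mulr.
Qed.

Lemma sqrt_mod_coprime (n x : nat) (s : int) : s ^+ 2 = 1 ->
  is_sqrt_mod n s x -> coprime x n.
Proof.
move=> s2 /dvdzP[q xq]; rewrite -[coprime _ _]/(coprimez x n).
apply/coprimezP; exists (s * x%:Z, - (s * q)) => /=.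
have -> : s * x * x = s * (x%:Z ^+ 2 - s) + s ^+ 2 by ring.
by rewrite xq s2; ring.
Qed.

Lemma sum_sqrt_mod n (s : int) : (3 <= n)%N -> odd n -> s ^+ 2 = 1 ->
  (\sum_(x < n) is_sqrt_mod n s x = 2 * half_sqrt_count n s)%N.
Proof.
move=> n3 on s2.
rewrite (@sum_symmetric_halfunits n (is_sqrt_mod n s)) //.
- congr (_ * _)%N; rewrite /half_sqrt_count -[RHS]sum1_card [RHS]big_mkcond.
  by apply: eq_bigr => i _; rewrite finset.in_set /is_sqrt_mod /halfrep; case: (_ %| _)%Z.
- by move=> x; apply: sqrt_modN.
- by move=> x; apply: sqrt_mod_coprime.
Qed.

(** By the Chinese remainder theorem, a sum over residues modulo [a * b] is a
    sum over pairs of residues. *)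
Lemma sum_crt (a b : nat) (F G : nat -> nat) : (0 < a)%N -> (0 < b)%N ->
  coprime a b ->
  (\sum_(x < a * b) F (x %% a) * G (x %% b) =
     (\sum_(x < a) F x) * (\sum_(x < b) G x))%N.
Proof.
move=> a0 b0 cab.
pose h (x : 'I_(a * b)) := (Ordinal (ltn_pmod x a0), Ordinal (ltn_pmod x b0)).
have hI : injective h.
  move=> x y [xa xb]; apply/val_inj => /=.
  have : (x == y %[mod a * b])%N by rewrite chinese_remainder // xa xb !eqxx.
  by rewrite !modn_small // => /eqP.
have hB : bijective h by apply: inj_card_bij hI _; rewrite card_prod !card_ord.
rewrite big_distrlr pair_big /= (reindex h) //=.
by apply: onW_bij.
Qed.

(** The number of square roots of [s] modulo [n] is multiplicative in [n], and
    is twice the number of those below [n / 2]. *)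
Lemma half_sqrt_count_coprime a b (s : int) :
    (3 <= a)%N -> (3 <= b)%N -> odd a -> odd b -> coprime a b -> s ^+ 2 = 1 ->
  (half_sqrt_count (a * b) s = 2 * (half_sqrt_count a s * half_sqrt_count b s))%N.
Proof.
move=> a3 b3 oa ob cab s2.
have := @sum_crt a b (is_sqrt_mod a s) (is_sqrt_mod b s).
have a0 : (0 < a)%N by lia.
have b0 : (0 < b)%N by lia.
move=> /(_ a0 b0 cab).
have ab3 : (3 <= a * b)%N by apply: leq_trans (leq_mul a3 (b0 : 1 <= b)%N).
have modE (c x : nat) : is_sqrt_mod c s (x %% c) = is_sqrt_mod c s x.
  rewrite /is_sqrt_mod.
  rewrite {2}(divn_eq x c) PoszD PoszM; set q := (_ %/ _)%N%:Z; set r := _%:Z.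
  have -> : (q * c%:Z + r) ^+ 2 - s = (c%:Z * (q ^+ 2 * c%:Z + 2 * q * r)) + (r ^+ 2 - s).
    by ring.
  by rewrite [RHS]rpredDl // dvdz_mulr.
rewrite (eq_bigr (fun x : 'I_(a * b) => nat_of_bool (is_sqrt_mod (a * b) s x))).
  rewrite (@sum_sqrt_mod (a * b)) ?oddM ?oa // !sum_sqrt_mod //.
  by rewrite mulnACA -mulnA => /eqP; rewrite eqn_mul2l /= => /eqP.
by move=> x _; rewrite !modE mulnb /is_sqrt_mod !dvdzE !absz_nat Gauss_dvd.
Qed.

Lemma card_halfunits_coprime a b :
    (3 <= a)%N -> (3 <= b)%N -> odd a -> odd b -> coprime a b ->
  (#|halfunits (a * b)| = 2 * (#|halfunits a| * #|halfunits b|))%N.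
Proof.
move=> a3 b3 oa ob cab; have b0 : (0 < b)%N by lia.
have ab3 : (3 <= a * b)%N by apply: leq_trans (leq_mul a3 (b0 : 1 <= b)%N).
have := totient_coprime cab; rewrite !totient_halfunits ?oddM ?oa //; nia.
Qed.

(** If [x] and [y] have the same square modulo [p ^ e] then [p ^ e] divides
    [(x - y) * (x + y)]. As [p] is odd and [x] is a unit, [p] cannot divide both
    factors, so [x] is congruent to [y] or to [- y]. *)
Lemma half_sqrt_count_prime_power p e (s : int) :
  prime p -> odd p -> (0 < e)%N -> s ^+ 2 = 1 -> (half_sqrt_count (p ^ e) s <= 1)%N.
Proof.
move=> pp op e0 s2; apply/card_le1_eqP => i j; rewrite !finset.in_set => ri rj.
set x := halfrep i in ri; set y := halfrep j in rj.
have xy : ((p ^ e)%N %| (x - y) * (x + y))%Z.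
  have -> : (x - y) * (x + y) = (x ^+ 2 - s) - (y ^+ 2 - s) by ring.
  exact: rpredB.
have cx : coprimez x p.
  by have := coprime_halfrep i; rewrite !coprimezE absz_nat coprime_pexpr.
have not_both : (p %| x - y)%Z -> (p %| x + y)%Z -> False.
  move=> pxB pxD; have : (p %| 2 * x)%Z.
    have -> : 2 * x = (x - y) + (x + y) by ring.
    exact: rpredD.
  rewrite Gauss_dvdzl; last by rewrite coprimez_sym.
  rewrite dvdzE /= => /dvdn_leq; have := prime_gt1 pp.
  by move: op; case: (p) => [|[|[|]]] //; lia.
have pe (z : int) : ((p ^ e)%N %| z)%Z -> (p %| z)%Z.
  by apply: dvdz_trans; rewrite dvdzE /= dvdn_exp.
apply/eqP/negPn/negP => ij.
have := cong_sign_halfrep i j; rewrite eq_sym (negbTE ij) /cong_sign -/x -/y => /eqP.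
rewrite subr_eq0 => /eqP -[] xyE.
have [pxB|npxB] := boolP (p %| x - y)%Z.
  have : ((p ^ e)%N %| x - y)%Z.
    rewrite -(@Gauss_dvdzl _ _ (x + y)) // coprimezE absz_nat coprime_pexpl //.
    by rewrite prime_coprime //; apply/negP => /(not_both pxB).
  move=> h; move: xyE; rewrite h; case E : (_ %| x + y)%Z => // _.
  exact: not_both (pe _ h) (pe _ E).
have : ((p ^ e)%N %| x + y)%Z.
  rewrite -(@Gauss_dvdzr _ (x - y)) // coprimezE absz_nat coprime_pexpl //.
  by rewrite prime_coprime.
move=> h; move: xyE; rewrite h; case E : (_ %| x - y)%Z => // _.
exact: not_both (pe _ E) (pe _ h).
Qed.

Lemma half_sqrt_count1_gt0 n : (3 <= n)%N -> (0 < half_sqrt_count n 1)%N.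
Proof.
case/halfrep_eq1 => i i1; apply/card_gt0P; exists i.
by rewrite finset.in_set i1.
Qed.

(** The equation is [#|S| = tr J + 2 b] for the involution [J], with the diagonal
    of [J] counted according to the sign of its entries. *)
Lemma det_invmul_mx_half_sqrt_count (C : numClosedFieldType) n : (3 <= n)%N -> odd n ->
  exists2 b : nat, \det (invmul_mx n C) = (-1) ^+ b &
    (half_sqrt_count n 1 + 2 * b = #|halfunits n| + half_sqrt_count n (-1))%N.
Proof.
move=> n3 on.
have [b db tb] := det_involution (@invmul_mx_involutive n n3 on C).
exists b => //; apply/eqP; rewrite -(eqr_nat C) natrD natrD -tb addrAC; apply/eqP.
congr (_ + _); apply/eqP; rewrite -subr_eq; apply/eqP.
have hr s : (half_sqrt_count n s)%:R =
    \sum_(i < #|halfunits n|) ((is_sqrt_mod n s (enum_val i) : nat)%:R : C).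
  rewrite -natr_sum /half_sqrt_count -sum1_card [X in X%:R]big_mkcond /=; congr (_%:R).
  by apply: eq_bigr => i _; rewrite finset.in_set /is_sqrt_mod /halfrep; case: (_ %| _)%Z.
rewrite !hr -sumrB; apply: eq_bigr => i _; rewrite !mxE /cong_sign rmorphB /=.
by rewrite -!expr2 /is_sqrt_mod opprK.
Qed.

Lemma odd_prime_power_ge3 p e : prime p -> odd p -> (0 < e)%N -> (3 <= p ^ e)%N.
Proof.
move=> pp op e0; have p3 : (3 <= p)%N by case: (p) pp op => [|[|[|]]].
by apply: leq_trans p3 _; rewrite -{1}[p]expn1 leq_exp2l ?prime_gt1.
Qed.

(** Whether [-1] is a square is read off the parity in
    [det_invmul_mx_half_sqrt_count], the counts being at most 1. This avoids
    producing a square root of [-1]. *)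
Lemma half_sqrt_count_prime_power_parity p e : prime p -> odd p -> (0 < e)%N ->
  half_sqrt_count (p ^ e) 1 = 1%N /\
  half_sqrt_count (p ^ e) (-1) = ~~ odd #|halfunits (p ^ e)|.
Proof.
move=> pp op e0.
have pe3 := odd_prime_power_ge3 pp op e0.
have ope : odd (p ^ e) by rewrite oddX op orbT.
have h1 := half_sqrt_count_prime_power pp op e0 (expr1n _ 2).
have h1p := half_sqrt_count1_gt0 pe3.
have hN := half_sqrt_count_prime_power pp op e0 (sqrrN 1).
have [b _] := det_invmul_mx_half_sqrt_count algC pe3 ope.
move: h1 h1p hN; move: (half_sqrt_count _ 1) (half_sqrt_count _ (-1)) #|_| => u v m.
by clear; case: (boolP (odd m)); lia.
Qed.

Lemma card_halfunits_prime_power p e : prime p -> odd p -> (0 < e)%N ->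
  (#|halfunits (p ^ e)| = p ^ e.-1 * p./2)%N.
Proof.
move=> pp op e0.
have pe3 := odd_prime_power_ge3 pp op e0.
have ope : odd (p ^ e) by rewrite oddX op orbT.
have := totient_halfunits pe3 ope; rewrite totient_pfactor //.
have := odd_double_half p; rewrite op; set k := p./2 => <- /=.
by rewrite -muln2; nia.
Qed.

Lemma odd_pow_mod4 p k : odd p ->
  (p ^ k %% 4 = if (p %% 4 == 3) && odd k then 3 else 1)%N.
Proof.
move=> op; have [p1|p3] : (p %% 4 = 1 \/ p %% 4 = 3)%N by lia.
  by rewrite -modnXm p1 exp1n.
rewrite p3 eqxx /= -modnXm p3; elim: k => // k IHk.
by rewrite expnS -modnMmr IHk /=; case: (odd k).
Qed.

(** For [n = p ^ e], [m] is the size of the half system and the multiplicity of the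
    eigenvalue [-1] of inversion is [m./2]. Its parity depends on
    [m] modulo 4 only, where [p ^ e.-1] is [1] or [3] and [p./2] depends on [p] modulo 8
    only. *)
Lemma eps_prime_power_parity p e m : odd p -> (0 < e)%N ->
  m = (p ^ e.-1 * p./2)%N ->
  odd m./2 = odd (if (p == 1 %[mod 8])%N || (p == 4 * e + 3 %[mod 8])%N
                  then m else (m + 1)%N).
Proof.
case: e => // e op _ /= mE; have := congr1 (modn ^~ 4) mE.
rewrite /= -modnMm odd_pow_mod4 // => m4; clear mE.
have e4 : ((4 * e.+1 + 3) %% 8 = if odd e then 3 else 7)%N.
  by case: (boolP (odd e)); lia.
rewrite e4; clear e4; move: m4.
have [k [r [-> rP]]] : exists k r, p = (8 * k + r)%N /\ (r = 1 \/ r = 3 \/ r = 5 \/ r = 7)%N.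
  by exists (p %/ 8)%N, (p %% 8)%N; split; lia.
have -> : ((8 * k + r) %% 4 = r %% 4)%N by lia.
have -> : ((8 * k + r) %% 8 = r)%N by lia.
have -> : ((8 * k + r)./2 %% 4 = r./2)%N by lia.
by case: (odd e); case: rP => [|[|[|]]] -> /=; lia.
Qed.

(** For [n = p ^ e * q ^ f], [m1] and [m2] are the sizes of the half systems of the
    two prime powers and [b] is the multiplicity of the eigenvalue [-1] of
    inversion modulo [n]. *)
Lemma eps_two_primes_parity p q m1 m2 b : odd p -> odd q ->
    odd m1 = (p %% 4 == 3)%N -> odd m2 = (q %% 4 == 3)%N ->
    (b.+1 = m1 * m2 + ~~ odd m1 * ~~ odd m2)%N ->
  odd b = ((p + q) %% 4 == 0)%N.
Proof.
move=> op oq hm1 hm2 bE.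
have := congr1 odd bE; rewrite /= oddD oddM; clear bE.
have -> : odd (~~ odd m1 * ~~ odd m2) = ~~ odd m1 && ~~ odd m2.
  by case: (odd m1); case: (odd m2).
rewrite hm1 hm2; clear hm1 hm2 m1 m2.
have [p4|p4] : (p %% 4 = 1 \/ p %% 4 = 3)%N by lia.
all: have [q4|q4] : (q %% 4 = 1 \/ q %% 4 = 3)%N by lia.
all: by rewrite p4 q4 -modnDm p4 q4 /=; case: (odd b).
Qed.

(** With three or more prime factors, splitting off two prime powers makes both
    the size of the half system and the square root counts divisible by 4,
    so the multiplicity of the eigenvalue [-1] is even. *)
Lemma det_invmul_mx (C : numClosedFieldType) n : (3 <= n)%N -> odd n ->
  \det (invmul_mx n C) = (eps n)%:~R.
Proof.
move=> n3 on.
have [b -> hb] := det_invmul_mx_half_sqrt_count C n3 on.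
have sgn k : odd b = odd k -> (-1 : C) ^+ b = ((-1 : int) ^+ k)%:~R.
  by move=> bk; rewrite rmorphXn rmorphN1 -signr_odd bk signr_odd.
have tot2 : (totient n)./2 = #|halfunits n|.
  by rewrite totient_halfunits // mul2n doubleK.
have pdP p e : (p, e) \in prime_decomp n ->
    [/\ prime p, odd p, (0 < e)%N & (3 <= p ^ e)%N /\ odd (p ^ e)].
  case/mem_prime_decomp => pp e0 pe.
  have ope : odd (p ^ e) by apply: dvdn_odd pe on.
  have op : odd p by move: ope; rewrite oddX eqn0Ngt e0.
  by split=> //; split=> //; apply: odd_prime_power_ge3.
have nE := prod_prime_decomp (ltn_trans (isT : 0 < 2)%N n3).
have upd : uniq [seq f.1 | f <- prime_decomp n].
  rewrite prime_decompE -map_comp (eq_map (_ : _ =1 id)) ?map_id ?primes_uniq //.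
rewrite /eps tot2.
have oddcard p e : (p, e) \in prime_decomp n ->
    odd #|halfunits (p ^ e)| = (p %% 4 == 3)%N.
  case/pdP => pp op e0 _; rewrite card_halfunits_prime_power // oddM oddX op orbT /=.
  by lia.
move: nE upd pdP oddcard; case: (prime_decomp n) => [|[p e] pd].
  by rewrite big_nil; lia.
rewrite big_cons /= => nE /andP[pnpd upd] pdP oddcard.
have [pp op e0 [pe3 ope]] := pdP _ _ (mem_head _ _).
have opm := oddcard _ _ (mem_head _ _).
have [hp1 hpN] := half_sqrt_count_prime_power_parity pp op e0.
case: pd => [|[q f] pd] in nE pnpd upd pdP oddcard *.
  rewrite big_nil muln1 in nE; subst n.
  rewrite hp1 hpN in hb.
  have bE : b = (#|halfunits (p ^ e)|./2).
    move: hb; move: #|_| => m; clear; case: (boolP (odd m)); lia.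
  have := eps_prime_power_parity op e0 (card_halfunits_prime_power pp op e0).
  by rewrite -bE => ob; case: ifP ob => _ ob; apply: sgn.
have [pq qf] : (p, e) \in [:: (p, e), (q, f) & pd] /\ (q, f) \in [:: (p, e), (q, f) & pd].
  by rewrite !inE !eqxx !orbT.
have [pq' oq f0 [qf3 oqf]] := pdP _ _ qf.
have oqm := oddcard _ _ qf.
have [hq1 hqN] := half_sqrt_count_prime_power_parity pq' oq f0.
rewrite big_cons /= in nE.
have npq : p != q by move: pnpd; rewrite inE negb_or => /andP[].
have cpq : coprime (p ^ e) (q ^ f).
  by rewrite coprimeXl // coprimeXr // prime_coprime // dvdn_prime2.
case: pd => [|[r g] pd] in nE pnpd upd pdP oddcard pq qf *.
  rewrite big_nil muln1 in nE; subst n.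
  rewrite !half_sqrt_count_coprime ?card_halfunits_coprime // ?sqrrN ?expr1n // in hb.
  rewrite ?card_halfunits_coprime //.
  rewrite hp1 hq1 hpN hqN in hb.
  have {}hb : (b.+1 = #|halfunits (p ^ e)| * #|halfunits (q ^ f)| +
      ~~ odd #|halfunits (p ^ e)| * ~~ odd #|halfunits (q ^ f)|)%N.
    move: hb; move: #|halfunits (p ^ e)| #|halfunits (q ^ f)| => u v.
    by clear; case: (odd u); case: (odd v); lia.
  have ob := eps_two_primes_parity op oq opm oqm hb.
  by case: ifP => c; apply: sgn; rewrite ob -[0%N](mod0n 4) c ?addn1 mul2n /= odd_double.
have [pr or g0 [rg3 org]] : [/\ prime r, odd r, (0 < g)%N & (3 <= r ^ g)%N /\ odd (r ^ g)].
  by apply: pdP; rewrite !inE eqxx !orbT.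
set n' := (\prod_(h <- _) _)%N in nE.
have n'3 : (3 <= n')%N.
  rewrite /n' big_cons /= (leq_trans rg3) // leq_pmulr //.
  rewrite big_seq; elim/big_ind: _ => // [x y x0 y0|[s h] sh]; first by rewrite muln_gt0 x0.
  have [//|ps _ _ _] := pdP s h; first by rewrite !inE sh !orbT.
  by rewrite expn_gt0 prime_gt0.
have on' : odd n' by move: on; rewrite nE !oddM => /and3P[].
have cn' s h : prime s -> s \notin [seq u.1 | u <- (r, g) :: pd] -> coprime (s ^ h) n'.
  move=> ps sn; rewrite coprimeXl // /n' big_seq.
  elim/big_ind: _ => [|x y cx cy|[u v] uv]; first by rewrite coprimen1.
    by rewrite coprimeMr cx.
  have [//|pu _ _ _] := pdP u v; first by rewrite in_cons in_cons uv !orbT.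
  rewrite coprimeXr // prime_coprime // dvdn_prime2 //.
  by apply: contraNneq sn => ->; apply/mapP; exists (u, v).
have cpn' : coprime (p ^ e) n'.
  by apply: cn' => //; move: pnpd; rewrite in_cons negb_or => /andP[].
have cqn' : coprime (q ^ f) n' by apply: cn' => //; move: upd; rewrite /= => /andP[].
have qn'3 : (3 <= q ^ f * n')%N by apply: leq_trans (leq_mul qf3 (ltnW (ltnW n'3))).
have cpqn' : coprime (p ^ e) (q ^ f * n') by rewrite coprimeMr cpq.
clearbody n'; subst n.
rewrite card_halfunits_coprime ?oddM ?oqf // card_halfunits_coprime //.
move: hb; rewrite !half_sqrt_count_coprime ?oddM ?oqf ?sqrrN ?expr1n //.
rewrite card_halfunits_coprime ?oddM ?oqf // card_halfunits_coprime //.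
rewrite hp1 hq1 hpN hqN => hb; apply: sgn; move: hb.
move: (half_sqrt_count _ _) (half_sqrt_count _ _) #|_| #|_| #|_| => u v x y z.
clear; rewrite !mul1n => hb.
have bE : b = (2 * (z * (y * x) + ~~ odd z * (~~ odd y * u) - v))%N.
  move: hb; rewrite !(mulnCA _ 2%N).
  by move: (z * (y * x))%N (~~ odd z * (~~ odd y * u))%N => s t; lia.
by rewrite bE !mul2n !odd_double.
Qed.

(** * Partial fractions of the cotangent *)

Section Cotangent.
Variable R : realType.
Implicit Types x y z : R.

Definition cot x : R := cos x / sin x.

Lemma cotN x : cot (- x) = - cot x.
Proof. by rewrite /cot cosN sinN invrN mulrN. Qed.

Lemma cotDpi x : cot (x + pi) = cot x.
Proof. by rewrite /cot cosDpi sinDpi invrN mulrNN. Qed.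

(** With the convention that inverses of 0 are 0, this also holds where the
    sine or the cosine vanishes. *)
Lemma tan_cot x : tan x = cot x - 2 * cot (x *+ 2).
Proof.
rewrite /tan /cot sin_mulr2n cos_mulr2n.
have := cos2Dsin2 x; set c := cos x; set s := sin x => cs.
have [s0|s0] := eqVneq s 0; first by rewrite s0 mulr0 mul0rn invr0 !mulr0 mul0r subrr.
have [c0|c0] := eqVneq c 0; first by rewrite c0 !mul0r mul0rn invr0 !mulr0 subrr.
have -> : (c ^+ 2 *+ 2 - 1) = c ^+ 2 - s ^+ 2 by rewrite -cs; ring.
by field; rewrite s0 c0.
Qed.

(** The second cotangent is the tangent of [x / 2]. *)
Lemma cot_half x : cot x = 2^-1 * (cot (x / 2) - cot ((pi - x) / 2)).
Proof.
have -> : cot ((pi - x) / 2) = tan (x / 2).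
  have -> : (pi - x) / 2 = - (x / 2 - pi / 2) by field.
  by rewrite /cot /tan cosN sinN cosBpihalf sinBpihalf opprK.
by rewrite tan_cot (_ : x / 2 *+ 2 = x); field.
Qed.

Lemma closed_MVT (f df : R -> R) a b : a < b ->
    (forall x, a <= x <= b -> is_derive x 1 f (df x)) ->
  exists2 c, a < c < b & f b - f a = df c * (b - a).
Proof.
move=> ab fdf.
have fd x : x \in `]a, b[ -> is_derive x 1 f (df x).
  by rewrite in_itv /= => /andP[ax xb]; apply: fdf; rewrite !ltW.
have fc : {within `[a, b], continuous f}%classic.
  apply: derivable_within_continuous => x.
  by rewrite in_itv /= => /fdf [].
by have [c] := MVT ab fd fc; rewrite in_itv /= => cab fE; exists c.
Qed.

Lemma sin_le_id x : 0 <= x -> sin x <= x.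
Proof.
rewrite le_eqVlt => /predU1P[<-|x0]; first by rewrite sin0.
have [t _] := @closed_MVT sin cos 0 x x0 (fun y _ => is_derive_sin y).
rewrite sin0 !subr0 => ->.
by rewrite ler_piMl ?cos_le1 // ltW.
Qed.

Lemma mul_cos_le_sin x : 0 <= x <= pi -> x * cos x <= sin x.
Proof.
case/andP; rewrite le_eqVlt => /predU1P[<-|x0] xpi; first by rewrite mul0r sin0.
have dE y : is_derive y 1 (fun z => sin z - z * cos z) (y * sin y).
  by apply: is_derive_eq; rewrite /GRing.scale /=; ring.
have [t /andP[t0 tx]] := @closed_MVT _ _ 0 x x0 (fun y _ => dE y).
rewrite sin0 mul0r !subr0 => fE; rewrite -subr_ge0 fE.
by rewrite !mulr_ge0 ?sin_ge0_pi ?ltW // (lt_le_trans tx).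
Qed.

Lemma sin_inv_sqr x : sin x != 0 -> sin x ^- 2 = cot x ^+ 2 + 1.
Proof.
move=> s0; rewrite -[LHS]mul1r -(cos2Dsin2 x) mulrDl expr_div_n.
by rewrite mulfV ?cos2Dsin2 // expf_neq0.
Qed.

(** The derivative of [cot t - t^-1] is [t ^- 2 - sin t ^- 2], which lies between
    [-1] and [0]: the upper bound is [sin t <= t], and, as
    [sin t ^- 2 = cot t ^+ 2 + 1], the lower bound is [t <= tan t]. *)
Lemma cot_sub_inv_lipschitz y z : 0 < y -> y < z -> z <= pi / 2 ->
  `| (cot y - y^-1) - (cot z - z^-1) | <= z - y.
Proof.
move=> y0 yz zpi.
pose dr x : R := - (sin x ^- 2) + x ^- 2.
have pi2 : pi / 2 < pi :> R by have := pi_gt0 R; lra.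
have s0 x : y <= x <= z -> 0 < x /\ 0 < sin x.
  case/andP=> yx xz; have x0 : 0 < x by apply: lt_le_trans yx.
  split=> //; apply: sin_gt0_pi; rewrite x0 /=.
  by rewrite (le_lt_trans (le_trans xz zpi)).
have dE x : y <= x <= z -> is_derive x 1 (fun t => cot t - t^-1) (dr x).
  move=> /s0 [x0 sx0].
  have sn0 : sin x != 0 by rewrite gt_eqF.
  have xn0 : x != 0 by rewrite gt_eqF.
  have ? := is_deriveV sn0 (is_derive_sin x).
  have ? := is_deriveV (f := id) xn0 (is_derive_id x 1).
  apply: is_derive_eq; rewrite /GRing.scale /= /dr [in RHS]sin_inv_sqr // /cot.
  by field; rewrite sn0 xn0.
have [t /andP[yt tz] fE] := closed_MVT yz dE.
have [t0 st0] : 0 < t /\ 0 < sin t by apply: s0; rewrite !ltW.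
rewrite distrC fE normrM [`|z - y|]gtr0_norm ?subr_gt0 //.
rewrite ler_piMl ?subr_ge0 ?(ltW yz) // /dr.
have tpi : 0 <= t <= pi by rewrite ltW //= (le_trans (ltW tz)) // (le_trans zpi) ?ltW.
have h1 : t ^- 2 <= sin t ^- 2.
  by rewrite lef_pV2 ?posrE ?exprn_gt0 // lerXn2r ?nnegrE ?sin_le_id // ltW.
have h2 : sin t ^- 2 - 1 <= t ^- 2.
  rewrite sin_inv_sqr ?gt_eqF // addrK /cot expr_div_n.
  rewrite ler_pdivrMr ?exprn_gt0 // mulrC ler_pdivlMr ?exprn_gt0 // -exprMn mulrC.
  rewrite lerXn2r ?nnegrE ?mul_cos_le_sin ?(ltW st0) // ltW // mulr_gt0 //.
  apply: cos_gt0_pihalf; rewrite (lt_le_trans tz) // andbT.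
  by rewrite (lt_trans _ t0) // oppr_lt0; have := pi_gt0 R; lra.
by rewrite ler_norml; apply/andP; split; lra.
Qed.

Lemma sum_fold (V : zmodType) (N : nat) (g : nat -> V) :
  \sum_(j < N + N) g j = \sum_(j < N) (g j + g (N + N - j.+1)%N).
Proof.
rewrite big_split_ord big_split; congr (_ + _).
rewrite [RHS](reindex_inj rev_ord_inj) /=; apply: eq_bigr => j _.
by congr g; have := ltn_ord j; lia.
Qed.

(** [cot_half] applied to every term doubles the number of terms: a term with
    index [j] contributes to the indices [j] and [2 ^ m.+1 - 1 - j]. *)
Lemma cot_dyadic x m : cot (pi * x) = (2 ^+ m.+1)^-1 *
  \sum_(j < 2 ^ m) (cot (pi * (j%:R + x) / 2 ^+ m.+1) -
                    cot (pi * (j%:R + 1 - x) / 2 ^+ m.+1)).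
Proof.
elim: m => [|m ->].
  rewrite expr1 big_ord_recl big_ord0 /= addr0 !add0r cot_half; congr (_ * (_ - cot _)).
  by field.
set q := 2 ^+ m.+1; have q0 : q != 0 :> R by rewrite expf_neq0 // pnatr_eq0.
have -> : 2 ^+ m.+2 = 2 * q by rewrite exprS.
pose g (j : nat) := cot (pi * (j%:R + x) / (2 * q)) - cot (pi * (j%:R + 1 - x) / (2 * q)).
rewrite -[X in _ = _ * X]/(\sum_(j < 2 ^ m.+1) g j) expnS mul2n -addnn sum_fold.
rewrite [(2 * q)^-1]invfM -mulrA mulrCA; congr (_ * _).
rewrite mulr_sumr; apply: eq_bigr => j _; rewrite /g.
have rE : (2 ^ m + 2 ^ m - j.+1)%N%:R = q - j%:R - 1 :> R.
  rewrite natrB; last by have := ltn_ord j; lia.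
  by rewrite addnn -mul2n -expnS natrX -natr1 /q; ring.
rewrite rE [LHS](congr2 (fun a b => a - b) (cot_half _) (cot_half _)).
have e1 : (pi - pi * (j%:R + x) / q) / 2 = pi * (q - j%:R - 1 + 1 - x) / (2 * q).
  by field.
have e2 : (pi - pi * (j%:R + 1 - x) / q) / 2 = pi * (q - j%:R - 1 + x) / (2 * q).
  by field.
have e3 y : pi * y / q / 2 = pi * y / (2 * q) by field.
by rewrite e1 e2 !e3; ring.
Qed.

Definition cot_partial_sum x N : R :=
  \sum_(j < N) ((j%:R + x)^-1 - (j%:R + 1 - x)^-1).

(** Replacing [cot y] by [y^-1] in [cot_dyadic] gives the partial sum. In each of
    the [2 ^ m] differences the error is at most the length
    [pi * (1 - 2 * x) / 2 ^ m.+1] between the two arguments, by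
    [cot_sub_inv_lipschitz]. All arguments are at most [pi / 2]. *)
Lemma cot_partial_sum_dyadic x m : 0 < x < 2^-1 ->
  `| pi * cot (pi * x) - cot_partial_sum x (2 ^ m) | <= pi ^+ 2 * 2^-1 ^+ m.
Proof.
case/andP=> x0 x12; have pi0 := pi_gt0 R.
set q : R := 2 ^+ m.+1; have q0 : 0 < q by rewrite exprn_gt0.
have qn0 : q != 0 by rewrite gt_eqF.
rewrite (cot_dyadic x m) -/q /cot_partial_sum mulrA mulr_sumr -sumrB.
apply: le_trans (ler_norm_sum _ _ _) _.
have qE : q = 2 * 2 ^+ m by rewrite /q exprS.
apply: (@le_trans _ _ (\sum_(j < 2 ^ m) pi ^+ 2 / q ^+ 2)); last first.
  rewrite sumr_const card_ord -[leLHS]mulr_natr natrX qE.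
  have m0 : (2 : R) ^+ m != 0 by rewrite expf_neq0 // pnatr_eq0.
  rewrite exprVn.
  rewrite (_ : _ / _ * _ = pi ^+ 2 / 2 ^+ m * 4^-1); last by field.
  rewrite ler_piMr ?divr_ge0 ?exprn_ge0 ?ltW //; lra.
apply: ler_sum => j _.
set u := pi * (j%:R + x) / q; set v := pi * (j%:R + 1 - x) / q.
have j0 : 0 <= j%:R :> R by rewrite ler0n.
have u0 : 0 < u by rewrite divr_gt0 // mulr_gt0 //; lra.
have uv : u < v by rewrite ltr_pM2r ?invr_gt0 // ltr_pM2l //; lra.
have vpi : v <= pi / 2.
  rewrite /v ler_pdivrMr // -mulrA ler_pM2l // qE mulKf ?pnatr_eq0 //.
  have : (j.+1%:R : R) <= 2 ^+ m by rewrite -natrX ler_nat ltn_ord.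
  by rewrite -natr1; lra.
have := cot_sub_inv_lipschitz u0 uv vpi.
have -> : u^-1 = q / pi * (j%:R + x)^-1.
  by rewrite /u; field; rewrite !gt_eqF //; lra.
have -> : v^-1 = q / pi * (j%:R + 1 - x)^-1.
  by rewrite /v; field; rewrite !gt_eqF //; lra.
move=> h.
set w := (X in `|X|).
have -> : w = pi / q * (cot u - q / pi / (j%:R + x) - (cot v - q / pi / (j%:R + 1 - x))).
  by rewrite /w; field; rewrite !gt_eqF //; lra.
rewrite normrM gtr0_norm ?divr_gt0 // expr2 expr2 invfM mulrACA ler_pM2l ?divr_gt0 //.
apply: le_trans h _; rewrite /u /v -mulrBl ler_pM2r ?invr_gt0 //.
by rewrite -mulrBr ler_piMr ?ltW //; lra.
Qed.

(** For [x < 1 / 2] the partial sums increase, so convergence along the powers of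
    2 is enough. *)
Lemma cvg_cot_partial_sum x : 0 < x < 2^-1 ->
  (cot_partial_sum x N @[N --> \oo] --> pi * cot (pi * x))%classic.
Proof.
move=> /andP[x0 x12]; set l := pi * _.
have mono : {homo cot_partial_sum x : a b / (a <= b)%N >-> a <= b}.
  apply: homo_leq => // [a b c|a]; first exact: le_trans.
  rewrite /cot_partial_sum big_ord_recr /= lerDl subr_ge0.
  have : 0 <= a%:R :> R by rewrite ler0n.
  by move=> a0; rewrite lef_pV2 ?posrE; lra.
have bnd m : `|l - cot_partial_sum x (2 ^ m)| <= pi ^+ 2 * 2^-1 ^+ m.
  by apply: cot_partial_sum_dyadic; rewrite x0.
have geo0 : (pi ^+ 2 * 2^-1 ^+ m @[m --> \oo] --> (0 : R))%classic.
  rewrite -[X in (_ --> X)%classic](mulr0 (pi ^+ 2)); apply: cvgMl_tmp.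
  by apply: cvg_expr; rewrite gtr0_norm ?invr_gt0 //; lra.
apply/cvgrPdist_le => e e0.
have [m _ mP] := (cvgrPdist_le _ _).1 geo0 e e0.
have subl a : cot_partial_sum x a <= l.
  apply/ler_addgt0Pr => d d0.
  have [k _ kP] := (cvgrPdist_le _ _).1 geo0 d d0.
  pose i := maxn a k.
  have := kP i (leq_maxr _ _).
  rewrite sub0r normrN ger0_norm ?mulr_ge0 ?exprn_ge0 ?pi_ge0 // ?invr_ge0 // => h.
  have := le_trans (bnd i) h; rewrite ler_norml => /andP[h1 _].
  have ai : (a <= 2 ^ i)%N by apply: leq_trans (leq_maxl a k) (ltnW (ltn_expl i _)).
  by have := mono _ _ ai; lra.
exists (2 ^ m)%N => // N mN /=.
have := mP m (leqnn m); rewrite sub0r normrN ger0_norm ?mulr_ge0 ?exprn_ge0 ?pi_ge0 // ?invr_ge0 // => h.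
have := le_trans (bnd m) h; rewrite ler_norml => /andP[_ h1].
rewrite ger0_norm ?subr_ge0 //; have := mono _ _ mN; lra.
Qed.

End Cotangent.

(** * The value at 1 of the L-function of an odd character *)

Definition cong_series (R : realType) (n k m : nat) : R :=
  \sum_(0 <= i < m) (cong_sign n i.+1 k)%:~R / i.+1%:R.

(** Among [n] consecutive integers one is congruent to [k] and one to [- k]. *)
Lemma cong_series_block (R : realType) n k N : (0 < k)%N -> (2 * k < n)%N ->
  \sum_(i < n) (cong_sign n (N * n + i).+1 k)%:~R / (N * n + i).+1%:R =
  (N%:R * n%:R + k%:R)^-1 - (N%:R * n%:R + n%:R - k%:R)^-1 :> R.
Proof.
move=> k0 kn.
have tE (i : 'I_n) : cong_sign n (N * n + i).+1 k =
    (i == k.-1 :> nat)%:Z - (i == (n - k).-1 :> nat)%:Z.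
  have [per _] := odd_periodic_cong_sign n k.
  rewrite (per _ i.+1%:Z); last first.
    by apply/dvdzP; exists N%:Z; rewrite -addnS PoszD PoszM addrK.
  rewrite /cong_sign; congr ((nat_of_bool _)%:Z - (nat_of_bool _)%:Z); have := ltn_ord i => ilt.
    apply/idP/eqP => [|ik]; last by rewrite [X in (_ %| X)%Z](_ : _ = 0) //; lia.
    rewrite dvdzE /= => dn; apply/eqP/negPn/negP => nab.
    by have := dvdn_leq _ dn; lia.
  rewrite -PoszD dvdzE /=; apply/idP/eqP => [/dvdnP[[|[|q]] qE]|ik]; [lia|lia|nia|].
  by rewrite (_ : i.+1 + k = n)%N //; lia.
have k1n : (k.-1 < n)%N by lia.
have k2n : ((n - k).-1 < n)%N by lia.
under eq_bigr => i _ do rewrite tE rmorphB mulrBl /=.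
rewrite sumrB; congr (_ - _).
  rewrite (bigD1 (Ordinal k1n)) //= big1 ?addr0 => [|i /negbTE ik]; last first.
    by rewrite -val_eqE /= in ik; rewrite ik mul0r.
  by rewrite eqxx mul1r -addnS prednK // natrD natrM.
rewrite (bigD1 (Ordinal k2n)) //= big1 ?addr0 => [|i /negbTE ik]; last first.
  by rewrite -val_eqE /= in ik; rewrite ik mul0r.
rewrite eqxx mul1r -addnS prednK; last by lia.
by rewrite natrD natrM natrB ?addrA //; lia.
Qed.

Lemma cong_series_mul (R : realType) n k N : (0 < k)%N -> (2 * k < n)%N ->
  cong_series R n k (N * n) = n%:R^-1 * cot_partial_sum (k%:R / n%:R) N.
Proof.
move=> k0 kn; have n0 : (n%:R : R) != 0 by rewrite pnatr_eq0; lia.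
elim: N => [|N IHN].
  by rewrite /cong_series big_geq // /cot_partial_sum big_ord0 mulr0.
rewrite /cot_partial_sum big_ord_recr mulrDr -/(cot_partial_sum _ N) -IHN.
rewrite /cong_series (big_cat_nat (n := (N * n)%N)) ?leq_pmull ?mulSn ?leq_addl //=.
congr (_ + _).
rewrite -{1}[(N * n)%N]add0n big_addn addnK big_mkord.
under eq_bigr => i _ do rewrite addnC.
rewrite cong_series_block // mulrBr -!invfM; congr (_^-1 - _^-1); by field.
Qed.

(** Complete blocks of [n] terms give the partial sums of the cotangent. The
    incomplete last block has fewer than [n] terms, each at most the inverse of
    the number of blocks plus 1. *)
Lemma cvg_cong_series (R : realType) n k : (0 < k)%N -> (2 * k < n)%N ->
  (cong_series R n k m @[m --> \oo] -->
     pi / n%:R * cot (pi * k%:R / n%:R))%classic.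
Proof.
move=> k0 kn; have n0 : (0 < n)%N by lia.
have nR0 : 0 < (n%:R : R) by rewrite ltr0n.
have divoo : ((m %/ n)%N @[m --> \oo] --> \oo)%classic by exact: cvg_divnr.
have -> : cong_series R n k = (fun m => n%:R^-1 * cot_partial_sum (k%:R / n%:R) (m %/ n)) \+
   (fun m => cong_series R n k m - cong_series R n k (m %/ n * n)).
  by apply/funext => m /=; rewrite cong_series_mul // addrC subrK.
rewrite -[X in (_ --> X)%classic]addr0; apply: cvgD.
  have -> : pi / n%:R * cot (pi * k%:R / n%:R) =
      n%:R^-1 * (pi * cot (pi * (k%:R / n%:R))) :> R by rewrite !mulrA [pi / _]mulrC.
  apply: cvgMl_tmp; apply: (cvg_comp _ _ divoo).
  apply: cvg_cot_partial_sum; rewrite divr_gt0 ?ltr0n //= ltr_pdivrMr //.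
  by rewrite mulrC ltr_pdivlMr ?ltr0n // -natrM ltr_nat mulnC.
have bnd m : `|cong_series R n k m - cong_series R n k (m %/ n * n)| <=
    n%:R * harmonic (m %/ n)%N.
  rewrite /cong_series (big_cat_nat (n := (m %/ n * n)%N)) ?leq_divM //= addrAC subrr add0r.
  apply: le_trans (ler_norm_sum _ _ _) _.
  apply: (@le_trans _ _ (\sum_(m %/ n * n <= i < m) harmonic (m %/ n)%N)).
    rewrite !big_nat; apply: ler_sum => i /andP[i1 i2].
    rewrite normrM -[leRHS]mul1r ler_pM //.
      by rewrite /cong_sign; case: (_ %| _)%Z; case: (_ %| _)%Z; rewrite /= ?normr1 ?normr0 ?normrN1.
    rewrite ger0_norm ?invr_ge0 // /harmonic lef_pV2 ?posrE ?ltr0Sn // ler_nat ltnS.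
    by apply: leq_trans i1; rewrite leq_pmulr.
  rewrite sumr_const_nat -[leLHS]mulr_natl ler_wpM2r ?harmonic_ge0 // ler_nat.
  by have := ltn_pmod m n0; have := divn_eq m n; lia.
have harm0 : (n%:R * harmonic (m %/ n)%N @[m --> \oo] --> (0 : R))%classic.
  rewrite -[X in (_ --> X)%classic](mulr0 n%:R); apply: cvgMl_tmp.
  by apply: (cvg_comp _ _ divoo); exact: cvg_harmonic.
apply/norm_cvg0P; apply: (squeeze_cvgr _ (cvg_cst 0) harm0).
by near=> m; rewrite normr_ge0 bnd.
Unshelve. all: by end_near.
Qed.

Lemma cvg_real_complex (R : realType) (u : nat -> R) (l : R) :
  (u m @[m --> \oo] --> l)%classic ->
  (((u m)%:C : R[i]^o) @[m --> \oo] --> (l%:C : R[i]^o))%classic.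
Proof.
move=> ul; apply/cvgrPdist_lt => e e0.
have eE : e = (complex.Re e)%:C by rewrite RRe_real // gtr0_real.
have e0' : 0 < complex.Re e by rewrite -ltcR -eE.
have [N _ NP] := (cvgrPdist_lt _ _).1 ul _ e0'.
exists N => // m mN /=; rewrite eE -rmorphB normc_def /= expr0n addr0 sqrtr_sqr ltcR.
exact: NP.
Qed.

Lemma natcpowN1 (R : realType) m : natcpow m.+1 (- 1 : R[i]) = (m.+1%:R^-1)%:C.
Proof.
rewrite /natcpow /= oppr0 mul0r cos0 sin0 mulN1r expRN lnK ?posrE ?ltr0Sn //.
by rewrite mulr1.
Qed.

(** The series does not converge absolutely. Expanding [chi] along the half
    system in the partial sums gives a combination of finitely many of the real
    sequences [cong_series], each of which converges. *)
Lemma dirichlet_L1 (R : realType) n (chi : int -> R[i]) :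
    (3 <= n)%N -> odd n -> odd_periodic n chi ->
    (forall z, ~~ coprimez z n -> chi z = 0) ->
  dirichlet_L 1 chi = \sum_(k < #|halfunits n|) chi (halfrep k) *
    (pi / n%:R * cot (pi * (halfrep k)%:~R / n%:R))%:C.
Proof.
move=> n3 on chiper chi0; rewrite /dirichlet_L.
apply: (@cvg_lim R[i]^o); first exact: norm_hausdorff.
have -> : series (fun m : nat => chi m.+1%:Z * natcpow m.+1 (- 1) : R[i]^o) =
    (fun m => \sum_(k < #|halfunits n|) chi (halfrep k) *
       ((cong_series R n (enum_val k) m)%:C : R[i]^o)).
  apply/funext => m; rewrite /series /=.
  transitivity (\sum_(0 <= i < m) \sum_(k < #|halfunits n|)
     chi (halfrep k) * ((cong_sign n i.+1 (halfrep k))%:~R / i.+1%:R : R)%:C).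
    apply: eq_bigr => i _; rewrite natcpowN1.
    rewrite (odd_periodic_expand n3 on chiper (chi0 _)) mulr_suml.
    apply: eq_bigr => k _; rewrite rmorphM rmorph_int.
    by rewrite [in RHS]mulrA [in RHS](mulrC (chi _)).
  rewrite exchange_big; apply: eq_bigr => k _.
  by rewrite -mulr_sumr rmorph_sum.
apply: cvg_big => [|k _]; first exact: add_continuous.
apply: (@cvgMl_tmp R[i] nat \oo%classic _
  (fun m => (cong_series R n (enum_val k) m)%:C)).
apply: cvg_real_complex.
have := enum_valP k; rewrite finset.in_set => /and3P[k0 kn _].
exact: cvg_cong_series.
Qed.

(** * The determinant of the tangent matrix *)

Lemma odd_dirichlet_charactersE (R : realType) n (f : int -> R[i]) :
  odd_dirichlet_characters R n f <-> odd_mult_periodic n f.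
Proof.
split=> [[[per nz mul] odd]|fomp].
  split=> //; split=> [|x]; first exact: periodic_congr.
  by rewrite -mulN1r mul odd mulN1r.
have f1 := odd_mult_periodic1 fomp; have [[per odd] mul nz] := fomp.
split; last by rewrite /odd_character odd f1.
by split=> // a; apply: per; rewrite addrAC subrr add0r.
Qed.

Lemma odd_periodic_cot (R : realType) n : (0 < n)%N ->
  odd_periodic n (fun z : int => cot (pi * z%:~R / n%:R : R)).
Proof.
move=> n0; have nR0 : (n%:R : R) != 0 by rewrite pnatr_eq0 -lt0n.
have shift (z : int) : cot (pi * (z + n%:Z)%:~R / n%:R : R) = cot (pi * z%:~R / n%:R).
  rewrite -[RHS]cotDpi; congr cot; rewrite rmorphD /= -pmulrn; by field.
split; last by move=> x; rewrite rmorphN mulrN mulNr cotN.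
exact: (@periodic_congr _ n (fun z : int => cot (pi * z%:~R / n%:R : R))).
Qed.

Lemma tan_mx_prod_mx (R : realType) n :
  map_mx (fun x : R => x%:C) (tan_mx R n) =
  prod_mx n (fun z => (cot (pi * z%:~R / n%:R : R))%:C -
                 2 * (cot (pi * (2 * z)%:~R / n%:R : R))%:C).
Proof.
apply/matrixP => j k; rewrite !mxE /= tan_cot rmorphB [X in _ - X]rmorphM rmorph_nat.
have -> : (enum_val j)%:R * (enum_val k)%:R * pi / n%:R =
   pi * (halfrep j * halfrep k)%:~R / n%:R :> R.
  by rewrite intrM /halfrep -!pmulrn; ring.
congr (_ - _ * (cot _)%:C).
by rewrite [in RHS]intrM; ring.
Qed.

(* The product is over a finite set of functions, hence the finitely supported
   big operator. *)
Theorem theorem1p7 (R : realType) (n : nat) (n_ge3 : (3 <= n)%N)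
    (n_odd : odd n) :
  (\det (tan_mx R n))%:C =
    (eps n)%:~R * ((n%:R / (pi : R)) ^+ (totient n)./2)%:C *
    \big[*%R/1]_(chi \in odd_dirichlet_characters R n)
      ((1 - 2 * chi 2%:Z) * dirichlet_L 1 chi).
Proof.
have n0 : (0 < n)%N by lia.
have [chi [chiI chiP chiS chiD]] := odd_characters_diag n_ge3 n_odd
  (@finite_order_diagonalizable R[i] _).
have chi_range : odd_dirichlet_characters R n = range chi.
  apply/seteqP; split=> [f /odd_dirichlet_charactersE/chiS[i <-]|f [i _ <-]]; first by exists i.
  exact/odd_dirichlet_charactersE.
have chi1 i : chi i 1 = 1 := odd_mult_periodic1 (chiP i).
pose f (z : int) : R[i] := (cot (pi * z%:~R / n%:R : R))%:C.
have fper : odd_periodic n f.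
  have [per odd] := odd_periodic_cot R n0.
  by split=> [x y xy|x]; rewrite /f; [rewrite (per x y)|rewrite odd rmorphN].
have c2 : coprimez 2 n by rewrite coprimezE coprime2n.
rewrite chi_range fsbig_image; last by move=> i j _ _; apply: chiI.
rewrite (_ : [set: _]%classic = [set` index_enum 'I_#|halfunits n|]%classic); last first.
  by apply/seteqP; split=> // i _; exact: mem_index_enum.
rewrite -fsbig_seq ?index_enum_uniq //.
rewrite -det_map_mx tan_mx_prod_mx (det_prod_mx_sub n_ge3 n_odd 2 fper c2).
have -> : \det (1%:M - 2 *: unitmul_mx n R[i] 2) = \prod_i (1 - 2 * chi i 2).
  have := chiD bool (fun b => if b then 1 else -2) (fun b => if b then 1 else 2).
  rewrite big_bool /= unitmul_mx1 scale1r scaleNr => ->.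
  by apply: eq_bigr => i _; rewrite big_bool /= chi1 mul1r mulNr.
rewrite chiD det_invmul_mx // totient_halfunits // mul2n doubleK.
have nR0 : (n%:R : R) != 0 by rewrite pnatr_eq0; lia.
have piR0 : (pi : R) != 0 by rewrite gt_eqF ?pi_gt0.
have LE i : dirichlet_L 1 (chi i) =
    (pi / n%:R)%:C * \sum_(k < #|halfunits n|) f (halfrep k) * chi i (halfrep k).
  have [chiper _ chinz] := chiP i.
  rewrite (dirichlet_L1 n_ge3 n_odd chiper) => [|z /negP ncz]; last first.
    by apply/eqP/negPn/negP => /chinz.
  by rewrite mulr_sumr; apply: eq_bigr => k _; rewrite rmorphM mulrC mulrA.
rewrite big_split /= (eq_bigr _ (fun i _ => LE i)) big_split prodr_const card_ord.
have piK : ((n%:R / pi) ^+ #|halfunits n|)%:C * (pi / n%:R)%:C ^+ #|halfunits n| = 1 :> R[i].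
  by rewrite -rmorphXn -rmorphM -exprMn mulrA divfK // divff // expr1n rmorph1.
have rearrange (K : comPzRingType) (x y e c d : K) :
    c * d = 1 -> x * y * e = e * c * (x * (d * y)).
  by move=> cd; rewrite -[LHS]mul1r -cd; ring.
exact: rearrange piK.
Qed.
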